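(* Let $\mathbf{w}=(w_j)_{j\ge 0}$ be a sequence of complex numbers. Let $n\ge 5$ be an integer and let $k\in\mathbb{N}$ be such that $2^k<n\le 2^{k+1}$. Put $$A_{\mathbf{w}}(n)=(-1)^n(w_{k+1}-2w_k)^{2n-2^{k+1}-1},\qquad B_{\mathbf{w}}(n)=2^{2n-3\cdot 2^k-1}(w_{k+1}-2w_k)^{2^k},$$ $$C_{\mathbf{w}}(n)=(-1)^n\frac{w_k^2}{w_{k+1}-2w_k},\qquad \mathbf{w}'=\left(w_0,w_1,\ldots,w_{k-1},\tfrac12 w_{k+1}\right).$$ (The products $A_{\mathbf{w}}(n)C_{\mathbf{w}}(n)$ and $B_{\mathbf{w}}(n)C_{\mathbf{w}}(n)$ below are understood as polynomials in the weights, after cancelling one factor $w_{k+1}-2w_k$.) (a) If $2^k<n\le 3\cdot 2^{k-1}$, then $$\begin{bmatrix}\mathcal{H}_{\mathbf{w}}(n)\\ \widetilde{\mathcal{G}}_{\mathbf{w}}(n)\end{bmatrix}=A_{\mathbf{w}}(n)\begin{bmatrix}-1&C_{\mathbf{w}}(n)\\0&1\end{bmatrix}\begin{bmatrix}\mathcal{H}_{\mathbf{w}}(2^{k+1}-n+1)\\ \widetilde{\mathcal{G}}_{\mathbf{w}}(2^{k+1}-n+1)\end{bmatrix}.$$ (b) If $3\cdot 2^{k-1}<n\le 2^{k+1}$, then $$\begin{bmatrix}\mathcal{H}_{\mathbf{w}}(n)\\ \widetilde{\mathcal{G}}_{\mathbf{w}}(n)\end{bmatrix}=B_{\mathbf{w}}(n)\begin{bmatrix}1&C_{\mathbf{w}}(n)\\0&1\end{bmatrix}\begin{bmatrix}\mathcal{H}_{\mathbf{w}'}(n-2^k)\\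 \widetilde{\mathcal{G}}_{\mathbf{w}'}(n-2^k)\end{bmatrix}.$$
   Context: $\mathbb{N}=\{0,1,2,\ldots\}$. For a sequence of complex weights $\mathbf{w}=(w_j)_{j\ge0}$ and $n\in\mathbb{N}$ with binary expansion $n=\sum_{j=0}^{l}\varepsilon_j2^j$, $\varepsilon_j\in\{0,1\}$, put $s_{\mathbf{w}}(n)=\sum_{j=0}^l w_j\varepsilon_j$ and $d_{\mathbf{w}}(n)=s_{\mathbf{w}}(n+1)-s_{\mathbf{w}}(n)$. For $n\ge1$ let $\mathcal{H}_{\mathbf{w}}(n)=\det[s_{\mathbf{w}}(i+j)]_{0\le i,j<n}$. Let $\widetilde{G}_{\mathbf{w}}(n)$ be the $n\times n$ matrix obtained from $[d_{\mathbf{w}}(i+j)]_{0\le i,j<n}$ by replacing every entry of the rightmost column with $1$, and $\widetilde{\mathcal{G}}_{\mathbf{w}}(n)=\det\widetilde{G}_{\mathbf{w}}(n)$. A finite weight sequence such as $\mathbf{w}'$ (indexed from $0$, with last entry at index $k$) is allowed when only the listed weights occur in the matrices; for size $n$ with $2^k<n\le2^{k+1}$ only $w_0,\ldots,w_{k+1}$ occur. *)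

(* Defs.v *)
From HB Require Import structures.
From mathcomp Require Import all_boot all_order all_algebra.
From mathcomp Require Import zify ring.
From mathcomp Require Export reals complex.

Set Implicit Arguments.
Unset Strict Implicit.
Unset Printing Implicit Defensive.

Import Order.TTheory GRing.Theory Num.Theory.
Local Open Scope ring_scope.

Section WeightedDigitSums.

Variable F : numFieldType.
Implicit Types (w : nat -> F) (n k : nat).

Definition bin_digit n j : nat := odd (n %/ 2 ^ j).

(* trunc_log 2 n is the index of the leading binary digit of n, and 0 if n = 0 *)
Definition digit_sum w n : F :=
  \sum_(j < (trunc_log 2 n).+1) w j * (bin_digit n j)%:R.

Definition digit_diff w n : F := digit_sum w n.+1 - digit_sum w n.

Definition hankel_det w n : F :=
  \det (\matrix_(i < n, j < n) digit_sum w (i + j)).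

Definition diff_mx w n : 'M[F]_n :=
  \matrix_(i, j) if j.+1 == n then 1 else digit_diff w (i + j).

Definition diff_det w n : F := \det (diff_mx w n).

(* A finite weight sequence is extended by zeros; the matrices it is used with
   do not involve the weights beyond the listed ones. *)
Definition half_weights w k : nat -> F :=
  fun j => (rcons (mkseq w k) (w k.+1 / 2))`_j.

Definition mx22 (a b c d : F) : 'M[F]_2 :=
  \matrix_(i, j) if i == 0 then (if j == 0 then a else b)
                 else (if j == 0 then c else d).

Definition det_col w n : 'cV[F]_2 :=
  \col_i if i == 0 then hankel_det w n else diff_det w n.

(* In the exponents below subtraction on nat is never truncated for the n and
   k at which they are used. *)
Definition coefA w n k : F :=
  (-1) ^+ n * (w k.+1 - 2 * w k) ^+ (2 * n - 2 ^ k.+1 - 1).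

Definition coefB w n k : F :=
  2 ^+ (2 * n - 3 * 2 ^ k - 1) * (w k.+1 - 2 * w k) ^+ (2 ^ k).

Definition coefC w n k : F :=
  (-1) ^+ n * (w k ^+ 2 / (w k.+1 - 2 * w k)).

(* The products A C and B C after cancelling one factor w_{k+1} - 2 w_k, so
   that they remain meaningful when that factor vanishes; the signs (-1) ^ n of
   A and C cancel out. *)
Definition coefAC w n k : F :=
  w k ^+ 2 * (w k.+1 - 2 * w k) ^+ (2 * n - 2 ^ k.+1 - 2).

Definition coefBC w n k : F :=
  (-1) ^+ n * 2 ^+ (2 * n - 3 * 2 ^ k - 1) * w k ^+ 2 *
  (w k.+1 - 2 * w k) ^+ (2 ^ k - 1).

Definition mxA w n k : 'M[F]_2 :=
  mx22 (- coefA w n k) (coefAC w n k) 0 (coefA w n k).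

Definition mxB w n k : 'M[F]_2 :=
  mx22 (coefB w n k) (coefBC w n k) 0 (coefB w n k).

Lemma scale_mx22 (x a b c d : F) :
  x *: mx22 a b c d = mx22 (x * a) (x * b) (x * c) (x * d).
Proof. by apply/matrixP => i j; rewrite !mxE; do 2!case: ifP. Qed.

Lemma mxA_factor w n k : (2 ^ k < n)%N -> w k.+1 - 2 * w k != 0 ->
  mxA w n k = coefA w n k *: mx22 (-1) (coefC w n k) 0 1.
Proof.
move=> lt_kn t0; rewrite scale_mx22 mulrN1 mulr0 mulr1 /mxA; congr mx22.
rewrite /coefAC /coefA /coefC.
have -> : (2 * n - 2 ^ k.+1 - 1 = (2 * n - 2 ^ k.+1 - 2).+1)%N.
  by rewrite expnS; lia.
move: (w k.+1 - _) t0 (subn _ 2) => t t0 e.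
rewrite mulrACA -expr2 sqrr_sign mul1r [t ^+ _.+1]exprS.
by field.
Qed.

Lemma mxB_factor w n k : w k.+1 - 2 * w k != 0 ->
  mxB w n k = coefB w n k *: mx22 1 (coefC w n k) 0 1.
Proof.
move=> t0; rewrite scale_mx22 mulr0 !mulr1 /mxB; congr mx22.
rewrite /coefBC /coefB /coefC.
move: (w k.+1 - _) t0 (2 * n - _ - 1)%N (expn_gt0 2 k) => t t0 e.
case: (2 ^ k)%N => // m _; rewrite subn1 /= [t ^+ _.+1]exprS.
by field.
Qed.

End WeightedDigitSums.

(* Main.v *)
Require Import Defs.
From mathcomp Require Import all_boot all_order all_algebra.
From mathcomp Require Import reals complex.
From mathcomp Require Import fingroup perm.
From mathcomp Require Import zify ring.

Import Order.TTheory GRing.Theory Num.Theory.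

Local Open Scope ring_scope.
Local Open Scope complex_scope.

(** Write N = 2^k, u = w_k, t = w_{k+1} - 2 w_k, s for the digit sum and
    n = N + m with 0 < m <= N.  The recurrences come from the self-similarity
      s(N + x) = u + s(x) for x < N,    s(2N + x) = 2u + t + s(x) for x < 2N
    ([self_similar]).  Subtracting from row and column N + i the row and column
    i leaves s(i + j) only in the leading N x N block: the other blocks become
    step functions of i + j ([det_hankel_step]), and taking differences of
    consecutive rows and columns past N turns the steps into isolated entries
    ([det_step_spike]).  The matrix is now [s(i + j)] bordered by one row and
    column of entries u with corner t, plus entries t that pair row N - j with
    row N + j.  Each pair contributes -t^2 and removes two rows and columns.

    If m <= N/2, all the rows N + j with j > 0 are used up in this way, and
    what is left is the border of [s(i + j)] with 0 <= i, j < N - m + 1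
    ([det_hankel_low]).
    If m > N/2, half of row N + i minus half of row N is first added to row i
    for i < m ([det_step_raise_half]).  This disconnects the rows N + j with
    j > N - m from the leading block, where it replaces s(x) by s(x) + t/2 for
    x >= N, that is, s_w by s_w'.  The disconnected rows form an antitriangular
    block with antidiagonal -2t ([det_hankel_high]).

    A bordered determinant is t det S - u^2 X(S), where X(S), the sum of all
    cofactors of S, equals det(S + J) - det S with J the all-ones matrix
    ([det_of_bordered]).  The determinant with a column of ones is X up to sign
    ([det_of_differences]), so the first rows of both matrix identities follow.
    Since adding a constant to s preserves the self-similarity and X, the
    identity for det at s + 1 minus the one at s gives the second rows. *)

(** * Determinants of matrices given by functions on indices *)

Section IndexedDet.

Variable R : comNzRingType.
Implicit Types (f g : nat -> nat -> R) (c : nat -> R) (s : nat -> nat) (n : nat).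

(** Indexing by nat rather than by ordinals lets rows be shifted and blocks be
    cut out without casts between matrix sizes. *)
Definition det_of f n : R := \det (\matrix_(i < n, j < n) f i j).

Lemma eq_det_of f g n :
  (forall i j, (i < n)%N -> (j < n)%N -> f i j = g i j) ->
  det_of f n = det_of g n.
Proof.
by move=> fg; congr (\det _); apply/matrixP => i j; rewrite !mxE fg.
Qed.

Lemma det_of_tr f n : det_of (fun i j => f j i) n = det_of f n.
Proof.
by rewrite -[RHS]det_tr; congr (\det _); apply/matrixP => i j; rewrite !mxE.
Qed.

Lemma det_of_scale_rows c f n :
  det_of (fun i j => c i * f i j) n = (\prod_(i < n) c i) * det_of f n.
Proof.
have -> : \prod_(i < n) c i = \det (diag_mx (\row_(i < n) c i)).
  by rewrite det_diag; apply: eq_bigr => i _; rewrite mxE.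
rewrite -det_mulmx mul_diag_mx; congr (\det _).
by apply/matrixP => i j; rewrite !mxE.
Qed.

(** The transformation is multiplication by a unitriangular matrix, so all rows
    may be modified at once, each by its own source row, provided that the
    sources all come earlier or all come later. *)
Lemma det_of_add_rows c s f n :
  (forall i, (i < n)%N -> c i = 0 \/ (s i < i)%N) \/
  (forall i, (i < n)%N -> c i = 0 \/ (i < s i < n)%N) ->
  det_of (fun i j => f i j + c i * f (s i) j) n = det_of f n.
Proof.
move=> tri.
pose L := \matrix_(i < n, j < n) ((i == j)%:R + c i * (s i == j)%:R) : 'M[R]_n.
have Lii i : L i i = 1.
  rewrite mxE eqxx; have [->|ne_s] : c i = 0 \/ (s i == i) = false.
    by case: tri => /(_ i (ltn_ord i)) [ci0|lt_s]; [left|right|left|right] => //; lia.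
    by rewrite mul0r addr0.
  by rewrite ne_s mulr0 addr0.
have detL : \det L = 1.
  case: tri => tri.
    rewrite det_trig; first by rewrite big1 // => i _; rewrite Lii.
    apply/is_trig_mxP => i j lt_ij; rewrite mxE.
    have -> : (i == j) = false by apply/negP => /eqP ij; move: lt_ij; rewrite ij ltnn.
    case: (tri i (ltn_ord i)) => [->|lt_s]; first by rewrite mul0r addr0.
    have -> : (s i == j) = false by lia.
    by rewrite mulr0 addr0.
  rewrite -[\det L]det_tr det_trig.
    by rewrite big1 // => i _; rewrite mxE Lii.
  apply/is_trig_mxP => i j lt_ij; rewrite !mxE.
  have -> : (j == i) = false by apply/negP => /eqP ij; move: lt_ij; rewrite ij ltnn.
  case: (tri j (ltn_ord j)) => [->|lt_s]; first by rewrite mul0r addr0.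
  have -> : (s j == i) = false by lia.
  by rewrite mulr0 addr0.
rewrite -[RHS]mul1r -detL -det_mulmx; congr (\det _).
apply/matrixP => i j; rewrite !mxE.
under eq_bigr => l _ do rewrite !mxE mulrDl.
rewrite big_split /= (bigD1 i) //= eqxx mul1r big1 ?addr0; last first.
  by move=> l /negbTE il; rewrite eq_sym il mul0r.
congr (_ + _).
have [->|lt_sn] : c i = 0 \/ (s i < n)%N.
  case: tri => /(_ i (ltn_ord i)) [->|lt_s]; [by left| |by left|];
  by right; move: (ltn_ord i); lia.
  by rewrite mul0r big1 // => l _; rewrite !mul0r.
rewrite (bigD1 (Ordinal lt_sn)) //= eqxx mulr1 big1 ?addr0 // => l ne_l.
suff -> : (s i == l) = false by rewrite mulr0 mul0r.
by apply/eqP => sl; case/eqP: ne_l; apply: val_inj.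
Qed.

Lemma det_of_congruence c s f n :
  (forall i, (i < n)%N -> c i = 0 \/ (s i < i)%N) \/
  (forall i, (i < n)%N -> c i = 0 \/ (i < s i < n)%N) ->
  det_of (fun i j => f i j + c i * f (s i) j
                     + c j * (f i (s j) + c i * f (s i) (s j))) n
  = det_of f n.
Proof.
move=> tri; rewrite -(@det_of_add_rows c s f n tri) -[RHS]det_of_tr.
by rewrite -[RHS](@det_of_add_rows c s _ n tri) -[RHS]det_of_tr.
Qed.

Lemma det_of_reindex s f n :
  (forall i, (i < n)%N -> (s i < n)%N) ->
  (forall i j, (i < n)%N -> (j < n)%N -> s i = s j -> i = j) ->
  det_of (fun i j => f (s i) (s j)) n = det_of f n.
Proof.
move=> s_lt s_inj.
pose s' (i : 'I_n) := Ordinal (s_lt i (ltn_ord i)).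
have s'_inj : injective s'.
  move=> i j /(congr1 val) /= sij; apply: val_inj.
  exact: s_inj sij.
pose p := perm s'_inj; pose M := \matrix_(i < n, j < n) f i j.
have -> : det_of (fun i j => f (s i) (s j)) n = \det (row_perm p (col_perm p M)).
  by congr (\det _); apply/matrixP => i j; rewrite !mxE !permE.
rewrite row_permE col_permE !det_mulmx !det_perm odd_permV.
by rewrite [\det M * _]mulrC mulrA -expr2 sqrr_sign mul1r.
Qed.

Lemma det_of_block_lower f a r :
  (forall i j, (i < a)%N -> (j < r)%N -> f i (a + j)%N = 0) ->
  det_of f (a + r) =
  det_of f a * det_of (fun i j => f (a + i)%N (a + j)%N) r.
Proof.
move=> f0.
rewrite /det_of -[X in \det X]submxK.
set A := ursubmx _; have -> : A = 0 by apply/matrixP => i j; rewrite !mxE /= f0.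
rewrite det_lblock; congr (_ * _); congr (\det _); apply/matrixP => i j;
by rewrite !mxE.
Qed.

Lemma det_of_scalar v n : det_of (fun i j => if i == j then v else 0) n = v ^+ n.
Proof.
rewrite -det_scalar; congr (\det _); apply/matrixP => i j.
by rewrite !mxE mulrb.
Qed.

(** Three row additions exchange two adjacent blocks of q rows and negate one of
    them; this replaces the sign of the block permutation. *)
Lemma det_of_swap_rows f a q :
  det_of (fun i j => if (i < a)%N then f i j else
                     if (i < a + q)%N then f (i + q)%N j
                     else - f (i - q)%N j) (a + q + q)
  = det_of f (a + q + q).
Proof.
pose c i : R := if (a <= i < a + q)%N then 1 else 0.
pose d i : R := if (a + q <= i)%N then -1 else 0.
rewrite -(@det_of_add_rows c (fun i => i + q)%N f); last first.
  by right=> i lt_i; rewrite /c; case: ifP => ai; [right; lia|left].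
rewrite -(@det_of_add_rows d (fun i => i - q)%N (fun i j => f i j + _)); last first.
  left=> i lt_i; rewrite /d; case: ifP => ai; [right; lia|by left].
rewrite -(@det_of_add_rows c (fun i => i + q)%N (fun i j => f i j + _ + _)); last first.
  by right=> i lt_i; rewrite /c; case: ifP => ai; [right; lia|left].
apply: eq_det_of => i j lt_i lt_j; rewrite /c /d.
case: (ltnP i a) => ia.
  have -> : (a + q <= i)%N = false by lia.
  by rewrite /= !mul0r !addr0.
case: (ltnP i (a + q)) => iq /=.
  have -> : (a + q <= i + q)%N by lia.
  have -> : (i + q < a + q)%N = false by lia.
  have -> : (a <= i + q - q < a + q)%N by lia.
  rewrite andbF addnK; ring.
have -> : (a <= i - q < a + q)%N by lia.
have -> : (i - q + q = i)%N by lia.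
ring.
Qed.

(** The matrix has the block form [[A, Y, 0], [Z, W, t], [0, t, 0]] with Y, Z, W
    arbitrary.  Exchanging its last two row blocks makes it block triangular, so
    t need not be invertible. *)
Lemma det_of_eliminate f a q t :
  (forall i j, (i < a)%N -> (j < q)%N ->
     f i (a + q + j)%N = 0 /\ f (a + q + j)%N i = 0) ->
  (forall i j, (i < q)%N -> (j < q)%N -> f (a + q + i)%N (a + q + j)%N = 0) ->
  (forall i j, (i < q)%N -> (j < q)%N ->
     f (a + i)%N (a + q + j)%N = (if i == j then t else 0) /\
     f (a + q + i)%N (a + j)%N = (if i == j then t else 0)) ->
  det_of f (a + q + q) = (-1) ^+ q * t ^+ (2 * q) * det_of f a.
Proof.
move=> f0 f00 fT; rewrite -det_of_swap_rows det_of_block_lower; last first.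
  move=> i j lt_i lt_j; case: ifP => [/f0 /(_ lt_j) [] //|ia].
  by rewrite lt_i (_ : i + q = a + q + (i - a))%N ?f00 //; lia.
rewrite -det_of_tr det_of_block_lower; last first.
  move=> i j lt_i lt_j; have -> : (a + j < a)%N = false by lia.
  by rewrite ltn_add2l lt_j addnAC; case: (f0 i j).
rewrite -det_of_tr.
rewrite (@eq_det_of _ f a) => [|i j lt_i lt_j]; last by rewrite lt_i.
rewrite [X in _ * X * _](@eq_det_of _ (fun i j => if i == j then t else 0));
  last first.
  move=> i j lt_i lt_j; have -> : (a + j < a)%N = false by lia.
  rewrite ltn_add2l lt_j addnAC; case: (fT j i) => // _ ->.
  by rewrite eq_sym.
rewrite [X in _ * X](@eq_det_of _ (fun i j => if i == j then - t else 0));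
  last first.
  move=> i j lt_i lt_j; have -> : (a + q + i < a)%N = false by lia.
  have -> : (a + q + i < a + q)%N = false by lia.
  have -> : (a + q + i - q = a + i)%N by lia.
  by case: (fT i j) => // -> _; case: ifP => // _; rewrite oppr0.
rewrite !det_of_scalar mul2n -addnn exprD [(- t) ^+ q]exprNn; ring.
Qed.

Lemma det_of_antitriangular f v r :
  (forall i j, (i + j + 1 < r)%N -> f i j = 0) ->
  (forall i j, (i + j + 1 = r)%N -> f i j = v) ->
  det_of f r = (-1) ^+ 'C(r, 2) * v ^+ r.
Proof.
elim: r f => [|r IHr] f f0 fv; first by rewrite /det_of det_mx00 mulr1.
rewrite /det_of (expand_det_row _ ord0) big_ord_recr /= big1 ?add0r => [|i _];
  last by rewrite mxE f0 ?mul0r //= addn1 ltnS ltn_ord.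
rewrite mxE fv /= ?addn1 // /cofactor add0n.
have -> : row' ord0 (col' ord_max (\matrix_(i < r.+1, j < r.+1) f i j)) =
          \matrix_(i < r, j < r) f i.+1 j.
  apply/matrixP => i j; rewrite !mxE /= /bump /=; congr (f _ _).
  by rewrite leqNgt ltn_ord.
rewrite -[\det _]/(det_of (fun i j => f i.+1 j) r) IHr.
- rewrite binS bin1 exprD [v ^+ r.+1]exprS /=; ring.
- by move=> i j ij; apply: f0; lia.
- by move=> i j ij; apply: fv; lia.
Qed.

(** det(S + y J) is affine in y for the all-ones matrix J, with slope the sum of
    the cofactors of S; the slope is the form in which that sum is used. *)
Definition sum_cofactors f n : R :=
  det_of (fun i j => f i j + 1) n - det_of f n.

Definition bordered f u t n i j : R :=
  if (i < n)%N then (if (j < n)%N then f i j else u)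
  else if (j < n)%N then u else t.

Lemma det_of_add_last_row (f g h : nat -> nat -> R) n :
  (forall i j, (i < n)%N -> f i j = g i j /\ f i j = h i j) ->
  (forall j, f n j = g n j + h n j) ->
  det_of f n.+1 = det_of g n.+1 + det_of h n.+1.
Proof.
move=> fgh fn; rewrite /det_of.
rewrite (determinant_multilinear (B := \matrix_(i, j) g i j)
  (C := \matrix_(i, j) h i j) (i0 := ord_max) (b := 1) (c := 1)).
- by rewrite !mul1r.
- by apply/rowP => j; rewrite !mxE !mul1r fn.
- apply/matrixP => i j; rewrite !mxE /=.
  by case: (fgh (lift ord_max i) j) => //; rewrite lift_max.
apply/matrixP => i j; rewrite !mxE /=.
by case: (fgh (lift ord_max i) j) => //; rewrite lift_max.
Qed.

(** The border is scaled by u once along its row and once along its column. *)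
Lemma det_of_bordered_corner f u n : det_of (bordered f u 0 n) n.+1 =
  u ^+ 2 * det_of (bordered f 1 0 n) n.+1.
Proof.
pose c i : R := if (i < n)%N then 1 else u.
have prodc : \prod_(i < n.+1) c i = u.
  rewrite big_ord_recr /= /c ltnn big1 ?mul1r // => i _.
  by rewrite ltn_ord.
have -> : u ^+ 2 = (\prod_(i < n.+1) c i) * \prod_(i < n.+1) c i.
  by rewrite prodc.
rewrite -mulrA -det_of_scale_rows -[X in _ = _ * X]det_of_tr.
rewrite -det_of_scale_rows -[LHS]det_of_tr.
apply: eq_det_of => i j _ _; rewrite /c /bordered.
by case: (ltnP i n) => _; case: (ltnP j n) => _; ring.
Qed.

Lemma det_of_last_col0 f n :
  (forall i, (i < n)%N -> f i n = 0) -> det_of f n.+1 = det_of f n * f n n.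
Proof.
move=> f0; rewrite -addn1 det_of_block_lower.
  by congr (_ * _); rewrite /det_of det_mx11 mxE addn0.
by move=> i [|j] // lt_i _; rewrite addn0 f0.
Qed.

(** Multilinearity in the last row and column reduces the claim to one pair of
    values of u and t.  For u = 1, t = -1, adding the last row to the others
    clears the last column and turns S into S + J. *)
Lemma det_of_bordered f u t n :
  det_of (bordered f u t n) n.+1 = t * det_of f n - u ^+ 2 * sum_cofactors f n.
Proof.
have split_corner v t' : det_of (bordered f v t' n) n.+1 =
    t' * det_of f n + v ^+ 2 * det_of (bordered f 1 0 n) n.+1.
  rewrite -det_of_bordered_corner.
  rewrite (@det_of_add_last_row _ (bordered f v 0 n)
    (fun i j => if (i < n)%N then bordered f v t' n i j
                else if (j < n)%N then 0 else t')); last first.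
  - by move=> j; rewrite /bordered ltnn; case: ifP; rewrite ?addr0 ?add0r.
  - by move=> i j lt_i; rewrite /bordered lt_i.
  rewrite addrC; congr (_ + _); rewrite -det_of_tr det_of_last_col0 ?ltnn //.
    rewrite mulrC det_of_tr; congr (_ * _); apply: eq_det_of => i j lt_i lt_j.
    by rewrite /bordered lt_i lt_j.
  by move=> i lt_i; rewrite lt_i.
have shifted : det_of (bordered f 1 (-1) n) n.+1 =
    - det_of (fun i j => f i j + 1) n.
  rewrite -(@det_of_add_rows (fun i => if (i < n)%N then 1 else 0) (fun=> n)).
    rewrite det_of_last_col0 /bordered ?ltnn ?mul0r ?addr0 ?mulrN1 //.
      congr (- _); apply: eq_det_of => i j lt_i lt_j; rewrite /= lt_i lt_j.
      by rewrite mul1r.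
    by move=> i lt_i; rewrite lt_i mul1r addrN.
  by right=> i _; case: ifP => lt_i; [right; lia|left].
move: shifted; rewrite (split_corner 1 (-1)) (split_corner u t) /sum_cofactors.
move: (det_of (bordered f 1 0 n) n.+1) (det_of f n) (det_of _ n) => b d e.
rewrite expr1n mul1r mulN1r => /(canRL (addKr _)) ->.
ring.
Qed.

(** With border 1 and corner 0, adding the border to the other rows turns S into
    S + J without changing the determinant, which is minus the sum of the
    cofactors. *)
Lemma sum_cofactors_shift f n :
  sum_cofactors (fun i j => f i j + 1) n = sum_cofactors f n.
Proof.
have := det_of_bordered f 1 0 n.
rewrite -(@det_of_add_rows (fun i => if (i < n)%N then 1 else 0) (fun=> n));
  last by right=> i _; case: ifP => lt_i; [right; lia|left].
rewrite (@eq_det_of _ (bordered (fun i j => f i j + 1) 1 0 n)).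
  rewrite det_of_bordered !mul0r !sub0r expr1n !mul1r; exact: oppr_inj.
move=> i j _ _; rewrite /bordered ltnn.
by case: (ltnP i n) => _; case: (ltnP j n) => _; rewrite ?mul1r ?mul0r ?addr0.
Qed.

Definition hankel (s : nat -> R) i j := s (i + j)%N.

(** Replacing each row of [s(i + j) + y] but the last one by its difference with
    the next row moves all dependence on y into the last row, where the slope is
    a row of ones. *)
Lemma det_of_differences (s : nat -> R) n : (0 < n)%N ->
  det_of (fun i j => if j.+1 == n then 1 else s (i + j).+1 - s (i + j)%N) n
  = (-1) ^+ n.-1 * sum_cofactors (hankel s) n.
Proof.
case: n => // n _ /=.
have detD y : det_of (fun i j => s (i + j)%N + y) n.+1 =
    det_of (fun i j => if (i < n)%N then s (i + j)%N - s (i + j).+1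
                    else s (i + j)%N + y) n.+1.
  rewrite -(@det_of_add_rows (fun i => if (i < n)%N then -1 else 0) S).
    apply: eq_det_of => i j _ _; rewrite addSn.
    by case: ifP => _; [ring|rewrite mul0r addr0].
  by right=> i _; case: ifP => lt_i; [right; lia|left].
have -> : sum_cofactors (hankel s) n.+1 =
    det_of (fun i j => if (i < n)%N then s (i + j)%N - s (i + j).+1 else 1) n.+1.
  rewrite /sum_cofactors detD -[X in _ - X](@eq_det_of (fun i j => s (i + j)%N + 0));
    last by move=> i j _ _; rewrite addr0.
  rewrite detD; apply: (canLR (addrK _)); rewrite addrC.
  apply: det_of_add_last_row => [i j lt_i|j]; first by rewrite lt_i.
  by rewrite ltnn addr0.
have <- : \prod_(i < n.+1) (if (i < n)%N then -1 else 1) = (-1) ^+ n :> R.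
  rewrite big_ord_recr /= ltnn mulr1 -[in RHS](card_ord n) -prodr_const.
  by apply: eq_bigr => i _; rewrite ltn_ord.
rewrite -(@det_of_scale_rows (fun i => if (i < n)%N then -1 else 1)) -[LHS]det_of_tr.
apply: eq_det_of => i j lt_i _; rewrite eqSS [(j + i)%N]addnC.
have -> : (i == n) = ~~ (i < n)%N by lia.
by case: (i < n)%N => /=; ring.
Qed.

End IndexedDet.

Arguments det_of {R} f n.
Arguments bordered {R} f u t n i j.
Arguments sum_cofactors {R} f n.
Arguments hankel {R} s i j.

(** * Reduction of a self-similar Hankel matrix *)

Section Reduction.

Variable F : numFieldType.
Variables (N : nat) (u t : F).

Implicit Types (s : nat -> F) (f : nat -> nat -> F).

(** The threshold a records how many initial rows and columns have had their
    step removed: 0 before, and m after, [det_step_raise_half]. *)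
Definition step_form f a i j : F :=
  let P i j := u + (if ((a <= i) && (2 * N <= i + j))%N then t else 0) in
  if (i < N)%N then (if (j < N)%N then f i j else P i j)
  else if (j < N)%N then P j i
  else t - (if (3 * N <= i + j)%N then 2 * t else 0).

(** The second differences of a step from t to -t are -2t followed by 2t. *)
Definition spike_form f a i j : F :=
  let P i j := if j == N then u else
               if ((a <= i) && (i + j == 2 * N))%N then t else 0 in
  if (i < N)%N then (if (j < N)%N then f i j else P i j)
  else if (j < N)%N then P j i
  else if (i == N) || (j == N) then (if i == j then t else 0)
  else if (i + j == 3 * N)%N then - (2 * t)
  else if (i + j == 3 * N + 1)%N then 2 * t else 0.

Lemma det_step_spike f a m : (0 < N)%N -> (m <= N)%N ->
  det_of (step_form f a) (N + m) = det_of (spike_form f a) (N + m).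
Proof.
move=> N0 le_m.
rewrite -(@det_of_congruence _ (fun i => if (N < i)%N then -1 else 0) predn);
  last by left=> i _; case: ifP => lt_i; [right; lia|left].
apply: eq_det_of => i j lt_i lt_j; rewrite /step_form /spike_form /=.
case: (ltngtP i N) => iN; case: (ltngtP j N) => jN.
all: repeat (case: ifP => ?); try (exfalso; lia).
all: try ring.
Qed.

(** The two cases correspond to the two ranges of n: either no row is left after the
    elimination of the pairs (r = 0), or the r remaining rows are disconnected
    from the leading block because the steps of its first p rows have been
    removed (a = p). *)
Lemma det_spike f a p q r : (p + q = N)%N ->
  [/\ a = 0, r = 0 & 2 * q < N]%N \/ a = p /\ (2 * q + r + 1 = N)%N ->
  det_of (spike_form f a) (N + 1 + q + r) =
  (-1) ^+ q * t ^+ (2 * q) * ((-1) ^+ 'C(r, 2) * (- (2 * t)) ^+ r) *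
  det_of (bordered f u t p) p.+1.
Proof.
move=> pq cases.
have [a_le cases'] : (a <= p)%N /\
    ((r = 0 /\ 2 * q < N)%N \/ a = p /\ (2 * q + r + 1 = N)%N).
  by case: cases => [[-> -> ?]|[-> ?]]; split => //; [left|right].
clear cases.
(* The order of the rows is: the p rows that stay, the border row N, the rows
   p, .., N - 1, their partners N + q, .., N + 1, and the r remaining ones. *)
pose s i := if (i < p)%N then i else if i == p then N
            else if (i <= N)%N then i.-1
            else if (i <= N + q)%N then (2 * N + q + 1 - i)%N else i.
have s_lt i : (i < N + 1 + q + r)%N -> (s i < N + 1 + q + r)%N.
  by move=> lt_i; rewrite /s; repeat case: ifP => ?; lia.
have s_inj i j : (i < N + 1 + q + r)%N -> (j < N + 1 + q + r)%N ->
    s i = s j -> i = j.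
  by move=> lt_i lt_j; rewrite /s; repeat case: ifP => ?; lia.
rewrite -(@det_of_reindex _ s _ _ s_lt s_inj).
have sA i : (i < p)%N -> s i = i by rewrite /s => ->.
have sN : s p = N by rewrite /s ltnn eqxx.
have sB i : (i < q)%N -> s (p + 1 + i)%N = (p + i)%N.
  by move=> lt_i; rewrite /s; repeat case: ifP => ?; lia.
have sC i : (i < q)%N -> s (p + 1 + q + i)%N = (N + q - i)%N.
  by move=> lt_i; rewrite /s; repeat case: ifP => ?; lia.
have sD i : s (p + 1 + q + q + i)%N = (N + q + 1 + i)%N.
  by rewrite /s; repeat case: ifP => ?; lia.
have s_le i : (i < p + 1 + q + q)%N -> (s i <= N + q)%N.
  by move=> lt_i; rewrite /s; repeat case: ifP => ?; lia.
clearbody s; have -> : (N + 1 + q + r = p + 1 + q + q + r)%N by lia.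
rewrite det_of_block_lower; last first.
  move=> i j /s_le le_si lt_j; rewrite sD /spike_form; move: (s i) le_si => si le_si.
  by repeat case: ifP => ?; first [done | exfalso; lia].
rewrite (@det_of_eliminate _ _ (p + 1) q t).
- rewrite (@det_of_antitriangular _ _ (- (2 * t)) r).
  + rewrite [RHS]mulrAC; congr (_ * _ * _); rewrite addn1.
    apply: eq_det_of => i j lt_i lt_j; rewrite /spike_form /bordered.
    have [->|i_p] : i = p \/ (i < p)%N by lia.
      have [->|j_p] : j = p \/ (j < p)%N by lia.
        by rewrite sN !ltnn !eqxx.
      have j_N : (j < N)%N by lia.
      by rewrite sN !ltnn eqxx (sA j) // j_N j_p.
    rewrite (sA i) // i_p; have -> : (i < N)%N by lia.
    have [->|j_p] : j = p \/ (j < p)%N by lia.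
      by rewrite sN !ltnn eqxx.
    have j_N : (j < N)%N by lia.
    by rewrite (sA j) // j_p j_N.
  + move=> i j ij; rewrite !sD /spike_form.
    by repeat case: ifP => ?; first [done | exfalso; lia].
  + move=> i j ij; rewrite !sD /spike_form.
    by repeat case: ifP => ?; first [done | exfalso; lia].
- move=> i j lt_i lt_j; rewrite sC //.
  have [->|i_p] : i = p \/ (i < p)%N by lia.
    rewrite sN /spike_form; split;
    by repeat case: ifP => ?; first [done | exfalso; lia].
  rewrite sA // /spike_form; split;
  by repeat case: ifP => ?; first [done | exfalso; lia].
- move=> i j lt_i lt_j; rewrite !sC // /spike_form.
  by repeat case: ifP => ?; first [done | exfalso; lia].
- move=> i j lt_i lt_j; rewrite !sB // !sC // /spike_form; split;
  by repeat case: ifP => ?; first [done | exfalso; lia].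
Qed.

Definition self_similar s :=
  (forall x, (x < N)%N -> s (N + x)%N = u + s x) /\
  (forall x, (x < 2 * N)%N -> s (2 * N + x)%N = 2 * u + t + s x).

Lemma self_similar_shift s y : self_similar s -> self_similar (fun x => s x + y).
Proof.
by case=> s1 s2; split=> x lt_x; [rewrite s1 ?addrA|rewrite s2 ?addrA].
Qed.

Lemma det_hankel_step s m : (0 < N)%N -> (m <= N)%N -> self_similar s ->
  det_of (hankel s) (N + m) = det_of (step_form (hankel s) 0) (N + m).
Proof.
move=> N0 le_m [s1 s2].
have sN x : (N <= x < 2 * N)%N -> s x = u + s (x - N)%N.
  by move=> bx; rewrite -s1 ?subnKC //; lia.
have s2N x : (2 * N <= x < 4 * N)%N -> s x = 2 * u + t + s (x - 2 * N)%N.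
  by move=> bx; rewrite -s2 ?subnKC //; lia.
rewrite -(@det_of_congruence _ (fun i => if (N <= i)%N then -1 else 0)
           (fun i => i - N)%N);
  last by left=> i _; case: ifP => lt_i; [right; lia|left].
have side i j : (i < N)%N -> (N <= j < N + m)%N ->
    s (i + j)%N - s (i + (j - N))%N = u + if (2 * N <= i + j)%N then t else 0.
  move=> lt_i lt_j; case: ifP => ij.
    rewrite s2N; last by lia.
    rewrite [s (i + _)%N]sN; last by lia.
    have -> : (i + (j - N) - N = i + j - 2 * N)%N by lia.
    ring.
  rewrite sN; last by lia.
  have -> : (i + (j - N) = i + j - N)%N by lia.
  ring.
apply: eq_det_of => i j lt_i lt_j; rewrite /step_form /hankel /=.
case: (ltnP i N) => iN; case: (ltnP j N) => jN.
- by rewrite !mul0r !addr0.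
- rewrite mul0r !addr0 -side ?jN //; ring.
- rewrite mul0r !addr0 [(i + j)%N]addnC [(i - N + j)%N]addnC mulN1r.
  by rewrite side ?iN.
have -> : (i + j = j + i)%N by lia.
have -> : s (j + i)%N = 2 * u + t + s (j - N + (i - N))%N.
  by rewrite s2N; [congr (_ + s _); lia|lia].
have -> : s (i + (j - N))%N = s (j - N + (i - N))%N +
    (u + if (3 * N <= j + i)%N then t else 0).
  have -> : (3 * N <= j + i)%N = (2 * N <= j - N + i)%N by lia.
  rewrite -side; [|lia|lia].
  have -> : (i + (j - N) = j - N + i)%N by lia.
  ring.
have -> : s (i - N + j)%N = s (j - N + (i - N))%N +
    (u + if (3 * N <= j + i)%N then t else 0).
  have -> : (3 * N <= j + i)%N = (2 * N <= i - N + j)%N by lia.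
  rewrite -side; [|lia|lia].
  have -> : (j - N + (i - N) = i - N + (j - N))%N by lia.
  ring.
have -> : (i - N + (j - N) = j - N + (i - N))%N by lia.
case: ifP => _; ring.
Qed.

(** For s = s_w this is the digit sum for the weights w'
    ([digit_sum_half_weights]). *)
Definition raise_half s x : F := s x + if (N <= x)%N then t / 2 else 0.

(** In column N + j, row N + i minus row N is -2t if i + j >= N and 0 otherwise,
    so that half of it cancels the step of size t in row i.  In column j < N the
    same difference is t if i + j >= N, and half of it raises s(i + j) by t/2.
    For i, j < m the row and the column contribute t/2 each, and the quarter of
    the entries -2t that comes from applying both takes t/2 back. *)
Lemma det_step_raise_half s m : (0 < N)%N -> (m <= N)%N ->
  det_of (step_form (hankel s) 0) (N + m) =
  det_of (step_form (fun i j => if ((i < m) || (j < m))%N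
                             then raise_half s (i + j) else s (i + j)%N) m)
         (N + m).
Proof.
move=> N0 le_m.
pose c i : F := if (i < m)%N then 1 / 2 else 0.
rewrite -(@det_of_congruence _ c (addn N)); last first.
  by right=> i _; rewrite /c; case: ifP => lt_i; [right; lia|left].
pose d i : F := if (i < m)%N then - (1 / 2) else 0.
rewrite -(@det_of_congruence _ d (fun=> N)); last first.
  by right=> i _; rewrite /d; case: ifP => lt_i; [right; lia|left].
have past_N x : (N + x < N)%N = false by lia.
have add_2N x y : (2 * N <= x + (N + y))%N = (N <= x + y)%N by lia.
have add_3N x y : (3 * N <= N + x + (N + y))%N = (N <= x + y)%N by lia.
apply: eq_det_of => i j lt_i lt_j; rewrite /c /d.
have -> : (N < m)%N = false by lia.
rewrite /step_form /hankel /raise_half.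
case: (ltnP i m) => im; case: (ltnP j m) => jm /=;
  rewrite ?mul0r ?addr0.
all: rewrite ?past_N ?add_2N ?add_3N ?ltnn.
all: case: (ltnP i N) => iN; case: (ltnP j N) => jN; try (exfalso; lia).
all: repeat (case: ifP => ?); try (exfalso; lia).
all: try reflexivity.
all: by field.
Qed.

Lemma sum_cofactors_hankel s n :
  sum_cofactors (hankel s) n =
  det_of (hankel (fun x => s x + 1)) n - det_of (hankel s) n.
Proof. by []. Qed.

Lemma sum_cofactors_hankel_shift s n :
  sum_cofactors (hankel (fun x => s x + 1)) n = sum_cofactors (hankel s) n.
Proof. exact: (sum_cofactors_shift _ (hankel s)). Qed.

Lemma det_hankel_low s p q : (p + q = N)%N -> (2 * q < N)%N ->
  self_similar s ->
  det_of (hankel s) (N + 1 + q) = (-1) ^+ q * t ^+ (2 * q) *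
    (t * det_of (hankel s) p - u ^+ 2 * sum_cofactors (hankel s) p).
Proof.
move=> pq q_small ss.
rewrite -addnA det_hankel_step ?det_step_spike //; try lia.
rewrite addnA -[(N + 1 + q)%N]addn0 (@det_spike _ 0 p q 0) //; last by left.
by rewrite det_of_bordered !expr0 !mulr1.
Qed.

(** The left-hand side collects the pivots of the case m > N/2: N - m pairs, and
    an antitriangular block of odd size.  The signs cancel only if N/2 is even,
    which is where n >= 5 enters. *)
Lemma pivot_product m : (m <= N)%N -> (N < 2 * m)%N -> (4 %| N)%N ->
  (-1) ^+ (N - m) * t ^+ (2 * (N - m)) *
    ((-1) ^+ 'C(2 * m - 1 - N, 2) * (- (2 * t)) ^+ (2 * m - 1 - N)) =
  2 ^+ (2 * m - 1 - N) * t ^+ N.-1.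
Proof.
move=> le_m lt_N /dvdnP[e eN].
pose h := (m - 1 - 2 * e)%N.
have -> : (2 * m - 1 - N = h.*2.+1)%N by rewrite /h; lia.
have -> : 'C(h.*2.+1, 2) = (h * h.*2.+1)%N.
  by rewrite bin2 -doubleMr doubleK mulnC.
have -> : t ^+ N.-1 = t ^+ (2 * (N - m)) * t ^+ h.*2.+1.
  by rewrite -exprD; congr (_ ^+ _); rewrite /h; lia.
have -> : (- (2 * t)) ^+ h.*2.+1 = - (2 ^+ h.*2.+1 * t ^+ h.*2.+1).
  by rewrite exprNn exprMn -signr_odd /= odd_double expr1 mulN1r.
have sign : (-1) ^+ (N - m) * (-1) ^+ (h * h.*2.+1) = -1 :> F.
  have odd_exp : odd (N - m + h * h.*2.+1).
    by rewrite oddD oddM /= odd_double andbT oddB // /h; lia.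
  by rewrite -exprD -signr_odd odd_exp.
move: sign; move: ((-1) ^+ (N - m)) ((-1) ^+ (h * h.*2.+1)) => e1 e2 sign.
rewrite -[RHS]mul1r -[1]opprK -sign; ring.
Qed.

Lemma det_hankel_high s m : (m <= N)%N -> (N < 2 * m)%N -> (4 %| N)%N ->
  self_similar s ->
  det_of (hankel s) (N + m) =
    2 ^+ (2 * m - 1 - N) * t ^+ N.-1 *
    (t * det_of (hankel (raise_half s)) m
     - u ^+ 2 * sum_cofactors (hankel (raise_half s)) m).
Proof.
move=> le_m lt_N N4 ss; rewrite -pivot_product //.
rewrite det_hankel_step ?det_step_raise_half ?det_step_spike //; try lia.
have -> : (N + m = N + 1 + (N - m) + (2 * m - 1 - N))%N by lia.
rewrite (@det_spike _ m m); [|lia|by right; split=> //; lia].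
rewrite -det_of_bordered; congr (_ * _); apply: eq_det_of => i j _ _.
by rewrite /bordered; case: (ltnP i m) => //; case: (ltnP j m).
Qed.

Lemma sum_cofactors_low s p q : (p + q = N)%N -> (2 * q < N)%N ->
  self_similar s ->
  sum_cofactors (hankel s) (N + 1 + q) =
  (-1) ^+ q * t ^+ (2 * q).+1 * sum_cofactors (hankel s) p.
Proof.
move=> pq q_small ss; rewrite sum_cofactors_hankel.
rewrite !(@det_hankel_low _ p) //; last exact: self_similar_shift.
rewrite sum_cofactors_hankel_shift [t ^+ _.+1]exprS [X in _ = _ * X]sum_cofactors_hankel.
move: (det_of (hankel s) p) (sum_cofactors _ p) (det_of _ p) => d c e; ring.
Qed.

Lemma sum_cofactors_high s m : (m <= N)%N -> (N < 2 * m)%N -> (4 %| N)%N ->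
  self_similar s ->
  sum_cofactors (hankel s) (N + m) =
    2 ^+ (2 * m - 1 - N) * t ^+ N.-1 *
    (t * sum_cofactors (hankel (raise_half s)) m).
Proof.
move=> le_m lt_N N4 ss; rewrite sum_cofactors_hankel.
rewrite !det_hankel_high //; last exact: self_similar_shift.
have shiftE x : raise_half (fun x => s x + 1) x = raise_half s x + 1.
  by rewrite /raise_half addrAC.
have -> : det_of (hankel (raise_half (fun x => s x + 1))) m =
    det_of (hankel (fun x => raise_half s x + 1)) m.
  by apply: eq_det_of => i j _ _; rewrite /hankel shiftE.
have -> : sum_cofactors (hankel (raise_half (fun x => s x + 1))) m =
    sum_cofactors (hankel (raise_half s)) m.
  rewrite -[RHS]sum_cofactors_hankel_shift; congr (_ - _);
  by apply: eq_det_of => i j _ _; rewrite /hankel shiftE.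
rewrite [X in _ = _ * (_ * X)]sum_cofactors_hankel.
move: (det_of (hankel _) m) (sum_cofactors _ m) (det_of _ m) => d c e; ring.
Qed.

End Reduction.

(** * Digit sums *)

Section DigitSums.

Variable F : numFieldType.
Implicit Types (w : nat -> F).

(** Leading zeros may be included, so that the digit sums of different numbers
    can be compared over the same range of digits. *)
Lemma digit_sumE w L n : (n < 2 ^ L)%N ->
  digit_sum w n = \sum_(j < L) w j * (bin_digit n j)%:R.
Proof.
move=> lt_n; pose S L := \sum_(0 <= j < L) w j * (bin_digit n j)%:R.
have S_stable L1 L2 : (n < 2 ^ L1)%N -> (L1 <= L2)%N -> S L2 = S L1.
  move=> lt1 le12; rewrite /S (big_cat_nat (n := L1)) //= -[RHS]addr0.
  congr (_ + _); rewrite big_nat_cond big1 // => j /andP[/andP[le1j _] _].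
  rewrite /bin_digit divn_small ?mulr0 //.
  by apply: leq_trans lt1 _; rewrite leq_exp2l.
rewrite /digit_sum -(big_mkord xpredT (fun j => w j * (bin_digit n j)%:R)).
rewrite -[RHS](big_mkord xpredT (fun j => w j * (bin_digit n j)%:R)) -!/(S _).
have lt_n' : (n < 2 ^ (trunc_log 2 n).+1)%N by apply: trunc_log_ltn.
by case: (leqP L (trunc_log 2 n).+1) => [|/ltnW] le; [|symmetry]; apply: S_stable.
Qed.

Lemma digit_sum_add_pow w k x : (x < 2 ^ k)%N ->
  digit_sum w (2 ^ k + x) = w k + digit_sum w x.
Proof.
move=> lt_x.
rewrite (@digit_sumE w k.+1); last by rewrite expnS; lia.
rewrite (@digit_sumE w k x) // big_ord_recr /= addrC; congr (_ + _).
  by rewrite /bin_digit divnDl // divnn expn_gt0 divn_small // mulr1.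
apply: eq_bigr => j _; congr (_ * _); rewrite /bin_digit.
have -> : (2 ^ k = 2 ^ (k - j) * 2 ^ j)%N by rewrite -expnD subnK // ltnW.
rewrite divnMDl ?expn_gt0 // oddD oddX.
by have -> : (k - j == 0)%N = false by move: (ltn_ord j); lia.
Qed.

Lemma eq_digit_sum w w' k x : (x < 2 ^ k)%N ->
  (forall j, (j < k)%N -> w j = w' j) -> digit_sum w x = digit_sum w' x.
Proof.
move=> lt_x eq_w; rewrite !(@digit_sumE _ k) //.
by apply: eq_bigr => j _; rewrite eq_w.
Qed.

Lemma self_similar_digit_sum w k :
  self_similar F (2 ^ k) (w k) (w k.+1 - 2 * w k) (digit_sum w).
Proof.
split=> x lt_x; first exact: digit_sum_add_pow.
rewrite -expnS digit_sum_add_pow ?expnS //; ring.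
Qed.

Lemma digit_sum_half_weights w k x : (x < 2 ^ k.+1)%N ->
  digit_sum (half_weights w k) x =
  raise_half F (2 ^ k) (w k.+1 - 2 * w k) (digit_sum w) x.
Proof.
have low y : (y < 2 ^ k)%N -> digit_sum (half_weights w k) y = digit_sum w y.
  move=> lt_y; apply: (@eq_digit_sum _ _ k) => // j lt_j.
  by rewrite /half_weights nth_rcons size_mkseq lt_j nth_mkseq.
move=> lt_x; rewrite /raise_half; case: leqP => le_x; last by rewrite addr0 low.
rewrite -(subnKC le_x) !digit_sum_add_pow ?low; try by move: lt_x; rewrite expnS; lia.
rewrite /half_weights nth_rcons size_mkseq ltnn eqxx; by field.
Qed.

Lemma hankel_detE w n : hankel_det w n = det_of (hankel (digit_sum w)) n.
Proof. by []. Qed.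

Lemma diff_detE w n : (0 < n)%N ->
  diff_det w n = (-1) ^+ n.-1 * sum_cofactors (hankel (digit_sum w)) n.
Proof. exact: det_of_differences. Qed.

Lemma det_col_eq w w' n m (a b d : F) :
  hankel_det w n = a * hankel_det w' m + b * diff_det w' m ->
  diff_det w n = d * diff_det w' m ->
  det_col w n = mx22 a b 0 d *m det_col w' m.
Proof.
move=> eqH eqG; apply/colP => i; rewrite !mxE !big_ord_recl big_ord0 !mxE /=.
by case: ifP => _; rewrite ?eqH ?eqG ?mul0r ?add0r addr0.
Qed.

End DigitSums.

(** * The recurrences *)

Lemma signr_parity (F : numFieldType) a b :
  odd a = odd b -> (-1) ^+ a = (-1) ^+ b :> F.
Proof. by move=> ab; rewrite -signr_odd ab signr_odd. Qed.

Section Recurrences.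

Variable F : numFieldType.
Implicit Types (w : nat -> F).

Lemma det_col_low w n k : (0 < k)%N -> (2 ^ k < n)%N ->
  (n <= 3 * 2 ^ k.-1)%N ->
  det_col w n = mxA w n k *m det_col w (2 ^ k.+1 - n + 1).
Proof.
case: k => // k _ lt_n; rewrite /= => le_n.
pose N := (2 ^ k.+1)%N; have NE : N = (2 * 2 ^ k)%N by rewrite /N expnS.
have N0 : (0 < 2 ^ k)%N by rewrite expn_gt0.
have ss := self_similar_digit_sum F w k.+1.
rewrite /mxA /coefA /coefAC [(2 ^ k.+2)%N]expnS.
rewrite -/N in lt_n ss *; move: ss.
move: (w k.+1) (w k.+2 - _) => u t ss.
pose q := (n - N - 1)%N; pose p := (N - q)%N.
have -> : (2 * N - n + 1 = p)%N by rewrite /p /q; lia.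
have -> : (2 * n - 2 * N - 1 = (2 * q).+1)%N by rewrite /q; lia.
have -> : (2 * n - 2 * N - 2 = 2 * q)%N by rewrite /q; lia.
have nE : n = (N + 1 + q)%N by rewrite /q; lia.
have pq : (p + q = N)%N by rewrite /p /q; lia.
have q2 : (2 * q < N)%N by rewrite /q; lia.
have p0 : (0 < p)%N by lia.
have n0 : (0 < n)%N by lia.
have sign_n : (-1) ^+ n = - (-1) ^+ q :> F.
  by rewrite -[RHS]mulN1r -exprS; apply: signr_parity; lia.
have sign_p : (-1) ^+ p.-1 = - (-1) ^+ q :> F.
  by rewrite -[RHS]mulN1r -exprS; apply: signr_parity; lia.
have sign_n1 : (-1) ^+ n.-1 = (-1) ^+ q :> F by apply: signr_parity; lia.
have signK : (-1) ^+ q * (-1) ^+ q = 1 :> F by rewrite -expr2 sqrr_sign.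
rewrite sign_n; apply: det_col_eq; rewrite ?hankel_detE !diff_detE ?sign_p //.
- rewrite {1}nE (@det_hankel_low F N u t _ p q) // [t ^+ _.+1]exprS.
  move: (det_of _ p) (sum_cofactors _ p) (t ^+ _) => d c e.
  ring: signK.
rewrite sign_n1 {1}nE (@sum_cofactors_low F N u t _ p q) //.
move: (sum_cofactors _ p) (t ^+ _) => c e; ring.
Qed.

Lemma det_col_high w n k : (1 < k)%N ->
  (3 * 2 ^ k.-1 < n <= 2 ^ k.+1)%N ->
  det_col w n = mxB w n k *m det_col (half_weights w k) (n - 2 ^ k).
Proof.
case: k => [|[|k]] // _; rewrite /= => /andP[lt_n le_n].
pose N := (2 ^ k.+2)%N; have NE : N = (4 * 2 ^ k)%N by rewrite /N !expnS; lia.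
have N0 : (0 < 2 ^ k)%N by rewrite expn_gt0.
have N4 : (4 %| N)%N by rewrite NE dvdn_mulr.
have ss := self_similar_digit_sum F w k.+2.
have half := @digit_sum_half_weights F w k.+2.
rewrite expnS in le_n; rewrite expnS in lt_n.
rewrite /mxB /Defs.coefB /coefBC.
rewrite -/N in le_n half ss *; move: ss half.
move: (w k.+2) (w k.+3 - _) => u t ss half.
pose m := (n - N)%N.
have nE : n = (N + m)%N by rewrite /m; lia.
have le_m : (m <= N)%N by lia.
have lt_N : (N < 2 * m)%N by lia.
have half_det : hankel_det (half_weights w k.+2) m =
    det_of (hankel (raise_half F N t (digit_sum w))) m.
  rewrite hankel_detE; apply: eq_det_of => i j lt_i lt_j.
  rewrite /hankel half // expnS -/N; lia.
have half_sum : sum_cofactors (hankel (digit_sum (half_weights w k.+2))) m =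
    sum_cofactors (hankel (raise_half F N t (digit_sum w))) m.
  congr (_ - _); apply: eq_det_of => i j lt_i lt_j;
  rewrite /hankel half // expnS -/N; lia.
have -> : (2 * n - 3 * N - 1 = 2 * m - 1 - N)%N by lia.
rewrite -/m; have sign_n : (-1) ^+ n = - (-1) ^+ m.-1 :> F.
  by rewrite -[RHS]mulN1r -exprS; apply: signr_parity; lia.
have sign_n1 : (-1) ^+ n.-1 = (-1) ^+ m.-1 :> F by apply: signr_parity; lia.
have signK : (-1) ^+ m.-1 * (-1) ^+ m.-1 = 1 :> F by rewrite -expr2 sqrr_sign.
have tN : t ^+ N = t ^+ N.-1 * t by rewrite -exprSr prednK; [|lia].
have m0 : (0 < m)%N by lia.
have n0 : (0 < n)%N by lia.
rewrite sign_n tN [(N - 1)%N]subn1; apply: det_col_eq;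
  rewrite ?half_det ?hankel_detE !diff_detE // half_sum ?sign_n1.
- rewrite {1}nE (@det_hankel_high F N u t) //.
  move: (det_of _ m) (sum_cofactors _ m) (t ^+ _) (2 ^+ _) => d c e f.
  ring: signK.
rewrite {1}nE (@sum_cofactors_high F N u t) //.
move: (sum_cofactors _ m) (t ^+ _) (2 ^+ _) => c e f; ring.
Qed.

End Recurrences.

Theorem theorem4p2 (R : realType) (w : nat -> R[i]) (n k : nat)
    (hn : (5 <= n)%N) (hk : (2 ^ k < n <= 2 ^ k.+1)%N) :
  ((n <= 3 * 2 ^ k.-1)%N ->
     det_col w n = mxA w n k *m det_col w (2 ^ k.+1 - n + 1)) /\
  ((3 * 2 ^ k.-1 < n)%N ->
     det_col w n = mxB w n k *m det_col (half_weights w k) (n - 2 ^ k)).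
Proof.
have [lt_n le_n] := andP hk.
have k2 : (1 < k)%N by case: k hk lt_n le_n => [|[|k]] //; lia.
split=> cmp_n; first by apply: det_col_low => //; lia.
by apply: det_col_high => //; rewrite cmp_n.
Qed.
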